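(* Let $(X,\mu)$ be a probability space and let $\varphi : X \to X$ be a measure-preserving mapping. For $1 \le p < \infty$ consider the composition operator $$T_\varphi : L^p(X,\mu) \to L^p(X,\mu), \quad f \mapsto f \circ \varphi.$$ Then the following assertions are equivalent: (i) The point $1$ is isolated in the spectrum $\sigma(T_\varphi)$. (ii) The mapping $\varphi$ is $\mu$-periodic. (iii) The operator $T_\varphi$ is uniformly ergodic. Moreover, if assertions (i) and (iii) hold for some $p \in [1,\infty)$, then they hold for every $p \in [1,\infty)$.
   Context: $\mathbb{N} = \{1,2,\dots\}$. $L^p(X,\mu)$ is the space of (classes of) complex-valued $p$-integrable functions. A mapping $\varphi : X \to X$ is $\mu$-periodic if there exists $n \in \mathbb{N}$ such that $\mu(\{x \in X : \varphi^n(x) = x\}) = 1$. A bounded linear operator $T$ is uniformly ergodic if the Cesàro averages $A_n[T] = \frac{1}{n}\sum_{k=0}^{n-1} T^k$, $n \in \mathbb{N}$, converge in operator norm as $n \to \infty$.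
   Formalization: (i)⇒(ii) and (iii)⇒(ii) are proved only when countably many measurable sets separate the points of a conull set (they fail, e.g., for the trivial σ-algebra on ℕ, φ(n)=n+1); all else holds for every probability space. μ-periodic means φ^n(x)=x for almost every x. *)

(* Defs.v *)
From HB Require Import structures.
From mathcomp Require Import all_boot all_order all_algebra ring_quotient.
From mathcomp Require Import all_classical all_reals all_analysis.
From mathcomp Require Import measurable_realfun complex.

Set Implicit Arguments.
Unset Strict Implicit.
Unset Printing Implicit Defensive.

Import Order.TTheory GRing.Theory Num.Theory Normc.
Import numFieldNormedType.Exports.

Local Open Scope classical_set_scope.
Local Open Scope ring_scope.
Local Open Scope complex_scope.
Local Open Scope quotient_scope.

Section cLfun_def.
Context d (X : measurableType d) (R : realType).
Variables (mu : {measure set X -> \bar R}) (p : R).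

(* MathComp-Analysis puts no sigma-algebra on R[i]; a complex function is
   measurable when its real and imaginary parts are. *)
Definition cmeasurable (f : X -> R[i]) :=
  measurable_fun setT (fun x => complex.Re (f x)) /\
  measurable_fun setT (fun x => complex.Im (f x)).

Definition cLnorm (f : X -> R[i]) : \bar R :=
  'N[mu]_p%:E[EFin \o (fun x => normc (f x))]%E.

(* p1 is a phantom argument: the algebraic instances below depend on it. *)
Definition cLfun (p1 : 1 <= p) : {pred X -> R[i]} :=
  mem [set f | cmeasurable f /\ (cLnorm f < +oo)%E].

End cLfun_def.

Section cmeasurable_theory.
Context d (X : measurableType d) (R : realType).
Implicit Types f g : X -> R[i].

Lemma cmeasurableD f g :
  cmeasurable f -> cmeasurable g -> cmeasurable (f + g).
Proof.
move=> [mf1 mf2] [mg1 mg2]; split.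
- rewrite (_ : (fun _ => _) = (fun x => complex.Re (f x)) \+ (fun x => complex.Re (g x))).
    exact: measurable_funD.
  by apply/funext => x /=; rewrite fctE; case: (f x) (g x) => [a b] [c e].
- rewrite (_ : (fun _ => _) = (fun x => complex.Im (f x)) \+ (fun x => complex.Im (g x))).
    exact: measurable_funD.
  by apply/funext => x /=; rewrite fctE; case: (f x) (g x) => [a b] [c e].
Qed.

Lemma cmeasurableZ (a : R[i]) f : cmeasurable f -> cmeasurable (a *: f).
Proof.
move=> [mf1 mf2]; case: a => a b; split.
- rewrite (_ : (fun _ => _) =
    (fun x => a * complex.Re (f x)) \- (fun x => b * complex.Im (f x))).
    by apply: measurable_funB; apply: measurable_funM.
  by apply/funext => x /=; rewrite fctE; case: (f x).
- rewrite (_ : (fun _ => _) =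
    (fun x => a * complex.Im (f x)) \+ (fun x => b * complex.Re (f x))).
    by apply: measurable_funD; apply: measurable_funM.
  by apply/funext => x /=; rewrite fctE; case: (f x).
Qed.

Lemma measurable_normc f :
  cmeasurable f -> measurable_fun setT (fun x => normc (f x)).
Proof.
move=> [mf1 mf2].
have msq : measurable_fun setT
    (fun x => complex.Re (f x) ^+ 2 + complex.Im (f x) ^+ 2).
  by apply: measurable_funD; apply: measurable_funX.
have msqrt : measurable_fun setT (@Num.sqrt R).
  by apply: continuous_measurable_fun => x; exact: sqrt_continuous.
rewrite (_ : (fun _ => _) = Num.sqrt \o
  (fun x => complex.Re (f x) ^+ 2 + complex.Im (f x) ^+ 2)).
  exact: measurableT_comp.
by apply/funext => x /=; case: (f x).
Qed.

Lemma cmeasurable_comp (phi : X -> X) f :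
  measurable_fun setT phi -> cmeasurable f -> cmeasurable (f \o phi).
Proof. by move=> mphi [mf1 mf2]; split;
  [exact: (measurableT_comp mf1 mphi)|exact: (measurableT_comp mf2 mphi)]. Qed.

End cmeasurable_theory.

Section cLnorm_theory.
Context d (X : measurableType d) (R : realType).
Variables (mu : {measure set X -> \bar R}) (p : R).
Hypothesis p1 : 1 <= p.
Implicit Types f g : X -> R[i].
Local Notation N := (cLnorm mu p).

Let p0 : 0 < p. Proof. exact: lt_le_trans p1. Qed.

Lemma cLnorm_ge0 f : (0 <= N f)%E.
Proof. exact: Lnorm_ge0. Qed.

Lemma normc_ge0 (z : R[i]) : 0 <= normc z.
Proof. by case: z => a b; rewrite /normc sqrtr_ge0. Qed.

Lemma normrcE (z : R[i]) : `|z| = (normc z)%:C.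
Proof. by []. Qed.

Lemma cLnormE f :
  N f = ((\int[mu]_x ((normc (f x)) `^ p)%:E) `^ p^-1)%E.
Proof.
rewrite /cLnorm unlock; congr (_ `^ _)%E; apply: eq_integral => x _ /=.
by rewrite ger0_norm ?normc_ge0.
Qed.

Let mpow f : cmeasurable f ->
  measurable_fun setT (fun x => ((normc (f x)) `^ p)%:E).
Proof.
move=> mf; apply/measurable_EFinP.
exact/(measurableT_comp (measurable_powR p))/measurable_normc.
Qed.

Lemma cLnorm_ae f g : cmeasurable f -> cmeasurable g ->
  {ae mu, forall x, f x = g x} -> N f = N g.
Proof.
move=> mf mg fg; rewrite !cLnormE; congr (_ `^ _)%E.
apply: ge0_ae_eq_integral => //; [exact: mpow|exact: mpow|..].
- by move=> x _; rewrite lee_fin powR_ge0.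
- by move=> x _; rewrite lee_fin powR_ge0.
- by apply: filterS fg => x -> _.
Qed.

Lemma cLnormD f g : cmeasurable f -> cmeasurable g ->
  (N (f + g)%R <= N f + N g)%E.
Proof.
move=> mf mg; have nf := measurable_normc mf; have ng := measurable_normc mg.
apply: (@le_trans _ _ 'N[mu]_p%:E[EFin \o
    ((fun x => normc (f x)) \+ (fun x => normc (g x)))%R]%E); last first.
  exact: minkowski_EFin.
have -> : 'N[mu]_p%:E[EFin \o
    ((fun x => normc (f x)) \+ (fun x => normc (g x)))%R]%E =
    ((\int[mu]_x ((normc (f x) + normc (g x)) `^ p)%:E) `^ p^-1)%E.
  rewrite unlock; congr (_ `^ _)%E; apply: eq_integral => x _ /=.
  by rewrite ger0_norm ?addr_ge0 ?normc_ge0.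
rewrite cLnormE; apply: gt0_ler_poweR.
- by rewrite invr_ge0 ltW.
- by rewrite in_itv/= leey andbT integral_ge0// => x _; rewrite lee_fin powR_ge0.
- by rewrite in_itv/= leey andbT integral_ge0// => x _; rewrite lee_fin powR_ge0.
have mfg := mpow (cmeasurableD mf mg).
have mfDg : measurable_fun setT (fun x => ((normc (f x) + normc (g x)) `^ p)%:E).
  apply/measurable_EFinP.
  exact: (measurableT_comp (measurable_powR p) (measurable_funD nf ng)).
apply: ge0_le_integral => //.
- by move=> x _; rewrite lee_fin powR_ge0.
- move=> x _; rewrite lee_fin; apply: ge0_ler_powR; first exact: ltW.
  + by rewrite nnegrE normc_ge0.
  + by rewrite nnegrE addr_ge0 ?normc_ge0.
  + exact: le_normcD.
Qed.

Lemma cLnormZ a f : cmeasurable f -> N (a *: f) = ((normc a)%:E * N f)%E.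
Proof.
move=> mf; rewrite !cLnormE.
under eq_integral => x _.
  rewrite fctE (_ : a *: f x = a * f x)// normcM powRM ?normc_ge0// EFinM.
  over.
rewrite ge0_integralZl//; first last.
- by rewrite lee_fin powR_ge0.
- by move=> x _; rewrite lee_fin powR_ge0.
- exact: mpow.
rewrite poweRM ?lee_fin ?powR_ge0//; last first.
  by apply: integral_ge0 => x _; rewrite lee_fin powR_ge0.
by rewrite poweR_EFin -powRrM divff ?gt_eqF// powRr1 ?normc_ge0.
Qed.

Lemma cLnorm0 : N 0 = 0%E.
Proof.
by rewrite -(scale0r (0 : X -> R[i])) cLnormZ ?normc0 ?mul0e//; split;
  exact: measurable_cst.
Qed.

Lemma cLnorm_eq0 f : cmeasurable f -> N f = 0%E ->
  {ae mu, forall x, f x = 0}.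
Proof.
move=> mf /Lnorm_eq0_eq0; rewrite lte_fin => /(_ _ p0).
move=> H; have {}H := H (measurableT_comp _ (measurable_normc mf)).
by apply: filterS (H _) => // x /(_ I) [] /eq0_normc.
Qed.

Lemma cLnorm_comp (phi : X -> X) f : measurable_fun setT phi ->
  (forall A, measurable A -> mu (phi @^-1` A) = mu A) ->
  cmeasurable f -> N (f \o phi) = N f.
Proof.
move=> mphi phimu mf; rewrite !cLnormE; congr (_ `^ _)%E.
have := @ge0_integral_pushforward _ _ X X R phi mphi mu setT
  (fun y => ((normc (f y)) `^ p)%:E) measurableT (mpow mf).
rewrite preimage_setT => <-; last first.
  by move=> y _; rewrite lee_fin powR_ge0.
apply: eq_measure_integral => A mA _.
exact: phimu.
Qed.

Lemma cLfun_submod_closed : submod_closed (cLfun mu p1).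
Proof.
split.
  rewrite inE/=; split; first by split; exact: measurable_cst.
  by rewrite cLnorm0 ltry.
move=> a f g; rewrite !inE/= => -[mf Nf] [mg Ng].
have maf := cmeasurableZ a mf; split; first exact: cmeasurableD.
rewrite (le_lt_trans (cLnormD maf mg))// lte_add_pinfty// cLnormZ//.
by rewrite lte_mul_pinfty// lee_fin normc_ge0.
Qed.

HB.instance Definition _ := GRing.isSubmodClosed.Build R[i] (X -> R[i])
  (cLfun mu p1) cLfun_submod_closed.

End cLnorm_theory.

Section cLfun_type.
Context d (X : measurableType d) (R : realType).
Variables (mu : {measure set X -> \bar R}) (p : R) (p1 : 1 <= p).

Record cLfunType := CLfun {
  cLfun_fun :> X -> R[i] ;
  _ : cLfun_fun \in cLfun mu p1 }.

HB.instance Definition _ := [isSub for cLfun_fun].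
HB.instance Definition _ := [Choice of cLfunType by <:].
HB.instance Definition _ := [SubChoice_isSubLmodule of cLfunType by <:].


Lemma cLfunTypeP (f : cLfunType) :
  cmeasurable f /\ (cLnorm mu p f < +oo)%E.
Proof. by case: f => f /=; rewrite inE. Qed.

Definition cLnull : {pred cLfunType} :=
  mem [set f : cLfunType | {ae mu, forall x, f x = 0}].

Lemma cLnull_zmod_closed : zmod_closed cLnull.
Proof.
split; first by rewrite inE/=; apply/nearW => x.
move=> f g; rewrite !inE/= => f0 g0.
by apply: filterS2 f0 g0 => x; rewrite !fctE => -> ->; rewrite subr0.
Qed.

HB.instance Definition _ :=
  GRing.isZmodClosed.Build cLfunType cLnull cLnull_zmod_closed.

Definition cLspace : Type := Quotient.quot cLnull.

HB.instance Definition _ := Choice.on cLspace.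
HB.instance Definition _ := EqQuotient.on cLspace.
HB.instance Definition _ := GRing.Zmodule.on cLspace.
HB.instance Definition _ := ZmodQuotient.on cLspace.

Lemma cLspace_eqP (f g : cLfunType) :
  \pi_cLspace f = \pi_cLspace g <-> {ae mu, forall x, f x = g x}.
Proof.
rewrite (rwP eqP) -[_ == _]/(f == g %[mod Quotient.quot cLnull]).
rewrite -Quotient.idealrBE inE/=; split; apply: filterS => x.
  by rewrite -[LHS]/(f x - g x) => /eqP; rewrite subr_eq0 => /eqP.
by move=> fg; rewrite -[LHS]/(f x - g x) fg subrr.
Qed.

Lemma cLspace_reprP (f : cLfunType) :
  {ae mu, forall x, repr (\pi_cLspace f) x = f x}.
Proof. by apply/cLspace_eqP; rewrite reprK. Qed.

Lemma cLspace_piD (f g : cLfunType) :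
  \pi_cLspace (f + g) = \pi_cLspace f + \pi_cLspace g.
Proof. exact: (raddfD (\pi_(Quotient.quot cLnull))). Qed.

Definition cLspace_scale (a : R[i]) (u : cLspace) : cLspace :=
  \pi_cLspace (a *: repr u).

Lemma cLspace_scale_pi a (f : cLfunType) :
  cLspace_scale a (\pi_cLspace f) = \pi_cLspace (a *: f).
Proof.
apply/cLspace_eqP; have := cLspace_reprP f.
apply: filterS => x fx.
by rewrite -[LHS]/(a * repr (\pi_cLspace f) x) -[RHS]/(a * f x) fx.
Qed.

Let scaleA a b u :
  cLspace_scale a (cLspace_scale b u) = cLspace_scale (a * b) u.
Proof.
elim/quotW: u => f; rewrite (cLspace_scale_pi b f) !cLspace_scale_pi.
by rewrite scalerA.
Qed.

Let scale1 : left_id 1 cLspace_scale.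
Proof. by elim/quotW => f; rewrite cLspace_scale_pi scale1r. Qed.

Let scaleDr : right_distributive cLspace_scale +%R.
Proof.
move=> a; elim/quotW => f; elim/quotW => g.
by rewrite -cLspace_piD !cLspace_scale_pi scalerDr cLspace_piD.
Qed.

Let scaleDl u : {morph cLspace_scale^~ u : a b / a + b}.
Proof.
move=> a b; elim/quotW: u => f.
by rewrite !cLspace_scale_pi scalerDl cLspace_piD.
Qed.

HB.instance Definition _ := GRing.Zmodule_isLmodule.Build R[i] cLspace
  scaleA scale1 scaleDr scaleDl.

Lemma cLspace_piZ a (f : cLfunType) :
  \pi_cLspace (a *: f) = a *: \pi_cLspace f.
Proof. by rewrite -cLspace_scale_pi. Qed.

(* MathComp norms take their values in the field of scalars, here R[i]. *)
Definition cLspace_norm (u : cLspace) : R[i] :=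
  (fine (cLnorm mu p (repr u)))%:C.

Lemma cLspace_norm_pi (f : cLfunType) :
  cLspace_norm (\pi_cLspace f) = (fine (cLnorm mu p f))%:C.
Proof.
rewrite /cLspace_norm; congr (fine _)%:C; apply: cLnorm_ae => //.
- by have [] := cLfunTypeP (repr (\pi_cLspace f)).
- by have [] := cLfunTypeP f.
- exact: cLspace_reprP.
Qed.

Lemma cLnorm_fin_num (f : cLfunType) : cLnorm mu p f \is a fin_num.
Proof. by rewrite ge0_fin_numE ?cLnorm_ge0; have [] := cLfunTypeP f. Qed.

Let normD u v : cLspace_norm (u + v) <= cLspace_norm u + cLspace_norm v.
Proof.
elim/quotW: u => f; elim/quotW: v => g.
rewrite -cLspace_piD !cLspace_norm_pi -rmorphD lecR -fineD ?cLnorm_fin_num//.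
have [[mf _] [mg _]] := (cLfunTypeP f, cLfunTypeP g).
apply: fine_le; last exact: (cLnormD mu p1 mf mg).
- exact: cLnorm_fin_num.
- by rewrite fin_numD !cLnorm_fin_num.
Qed.

Let normZ a u : cLspace_norm (a *: u) = `|a| * cLspace_norm u.
Proof.
elim/quotW: u => f; rewrite -cLspace_piZ !cLspace_norm_pi.
have [mf _] := cLfunTypeP f.
by rewrite cLnormZ// fineM ?cLnorm_fin_num// rmorphM.
Qed.

Let norm0 u : cLspace_norm u = 0 -> u = 0.
Proof.
have -> : 0 = \pi_cLspace (0 : cLfunType).
  by rewrite (raddf0 (\pi_(Quotient.quot cLnull))).
elim/quotW: u => f; rewrite cLspace_norm_pi => -[N0]; apply/cLspace_eqP.
have [mf _] := cLfunTypeP f.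
by apply: (cLnorm_eq0 p1 mf); rewrite -[LHS]fineK ?cLnorm_fin_num// N0.
Qed.

HB.instance Definition _ := Lmodule_isNormed.Build R[i] cLspace
  normD normZ norm0.

Lemma cLspace_normE (f : cLfunType) :
  `|\pi_cLspace f| = (fine (cLnorm mu p f))%:C.
Proof. exact: cLspace_norm_pi. Qed.

End cLfun_type.

Section koopman.
Context d (X : measurableType d) (R : realType).
Variable mu : {measure set X -> \bar R}.

Definition measure_preserving (phi : X -> X) :=
  measurable_fun setT phi /\
  forall A, measurable A -> mu (phi @^-1` A) = mu A.

Variables (phi : X -> X) (hphi : measure_preserving phi).
Variables (p : R) (p1 : 1 <= p).
Local Notation Lp := (cLspace mu p1).

Lemma cLfun_comp (f : cLfunType mu p1) : (f \o phi) \in cLfun mu p1.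
Proof.
have [mphi phimu] := hphi; have [mf Nf] := cLfunTypeP f.
rewrite inE/=; split; first exact: cmeasurable_comp.
by rewrite cLnorm_comp.
Qed.

Definition koopman_fun (u : Lp) : Lp := \pi_Lp (CLfun (cLfun_comp (repr u))).

Lemma koopmanE (f : cLfunType mu p1) :
  koopman_fun (\pi_Lp f) = \pi_Lp (CLfun (cLfun_comp f)).
Proof.
have [mphi phimu] := hphi.
apply/cLspace_eqP => /=; have [N [mN N0 fN]] := cLspace_reprP f.
exists (phi @^-1` N); split.
- by rewrite -[X in measurable X]setTI; exact: mphi.
- by rewrite phimu.
- by move=> x /= H; exact: fN.
Qed.

Lemma koopman_is_linear : linear koopman_fun.
Proof.
move=> a; elim/quotW => f; elim/quotW => g.
rewrite -cLspace_piZ -cLspace_piD !koopmanE.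
rewrite -cLspace_piZ -cLspace_piD; congr (\pi_Lp _).
exact/val_inj.
Qed.

HB.instance Definition _ :=
  GRing.isLinear.Build R[i] Lp Lp _ koopman_fun koopman_is_linear.

Definition koopman : {linear Lp -> Lp} := koopman_fun.

Lemma norm_koopman u : `|koopman u| = `|u|.
Proof.
have [mphi phimu] := hphi; elim/quotW: u => f.
rewrite /koopman/= koopmanE !cLspace_normE/= cLnorm_comp//.
by have [] := cLfunTypeP f.
Qed.

End koopman.

Arguments koopman {d X R mu phi} hphi {p} p1.

Section spectrum.
Context (R : realType) (V : normedModType R[i]).

Definition spectrum (T : {linear V -> V}) : set R[i] :=
  [set a | ~ exists S : {linear V -> V}, [/\ continuous S,
      forall v, S (a *: v - T v) = v & forall v, a *: S v - T (S v) = v]].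

(* R[i]^o carries the topology of the modulus. *)
Definition isolated_in_spectrum (T : {linear V -> V}) (a : R[i]) :=
  isolated (spectrum T : set R[i]^o) a.

(* The value at n = 0, where the average is undefined, is 0. *)
Definition cesaro_mean (T : V -> V) (n : nat) : V -> V :=
  fun v => n%:R^-1 *: \sum_(k < n) iter k T v.

End spectrum.

Section uniform_ergodicity.
Context (R : realType) (V : normedModType R[i]).

Definition opnorm (S : V -> V) : \bar R :=
  ereal_sup [set (complex.Re `|S v|)%:E | v in [set v : V | `|v| <= 1]].

Definition uniformly_ergodic (T : {linear V -> V}) :=
  exists2 P : {linear V -> V}, continuous P &
    opnorm (cesaro_mean T n \- P) @[n --> \oo] --> 0%E.

End uniform_ergodicity.

Section periodicity.
Context d (X : measurableType d) (R : realType).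
Variable mu : {measure set X -> \bar R}.

(* For a probability mu, "almost everywhere" says that the set of x with
   phi^n x = x contains a measurable set of measure 1; this is the statement
   mu {x | phi^n x = x} = 1, read in the completion of mu, as this set need
   not be measurable. *)
Definition mu_periodic (phi : X -> X) :=
  exists2 n, (0 < n)%N & {ae mu, forall x, iter n phi x = x}.

(* The sigma-algebra separates the points of a conull set by countably many
   sets, as in every standard (Lebesgue) probability space. L^p only sees phi
   through the sigma-algebra, so without such a condition pointwise
   periodicity cannot be recovered from the composition operator: for the
   trivial sigma-algebra on nat, with mu its only probability, and phi = succn
   the composition operator is the identity, while phi has no periodic point. *)
Definition countably_separated :=
  exists2 E : nat -> set X, forall i, measurable (E i) &
    exists2 N : set X, mu.-negligible N &
      forall x y, ~ N x -> ~ N y -> (forall i, E i x <-> E i y) -> x = y.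

End periodicity.

(* Main.v *)
(* If phi is periodic of period n modulo null sets, the operator T satisfies
   T^n = 1: its spectrum consists of n-th roots of unity and its Cesaro means
   tend to A_n at rate O(1/m). Otherwise, for every N some set B of positive
   measure is disjoint from its first N preimages. On the levels of such a tower
   T is a shift, so every point of the unit circle is an approximate eigenvalue
   of T, in every L^p. Approximate eigenvalues arbitrarily close to 1 exclude
   both the isolation of 1 in the spectrum and uniform ergodicity. Finally,
   periodicity modulo null sets does not involve p, and it gives back pointwise
   periodicity when countably many sets separate the points. *)

From HB Require Import structures.
Require Import Defs.
From mathcomp Require Import all_boot all_order all_algebra ring_quotient.
From mathcomp Require Import all_classical all_reals all_analysis.
From mathcomp Require Import measurable_realfun complex ring lra.

Set Implicit Arguments.
Unset Strict Implicit.
Unset Printing Implicit Defensive.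

Import Order.TTheory GRing.Theory Num.Theory Normc.
Import numFieldNormedType.Exports.

Local Open Scope classical_set_scope.
Local Open Scope ring_scope.
Local Open Scope complex_scope.
Local Open Scope quotient_scope.

(** * Real-valued norms and bounded linear maps *)

Section real_norm.
Context (R : realType) (V : normedModType R[i]).
Implicit Types u v : V.

Definition rnorm v : R := complex.Re `|v|.

Lemma normrE_rnorm v : `|v| = (rnorm v)%:C.
Proof. by rewrite /rnorm RRe_real// ger0_real. Qed.

Lemma rnorm_ge0 v : 0 <= rnorm v.
Proof. by rewrite -ler0c -normrE_rnorm normr_ge0. Qed.

Lemma rnorm_eq0 v : (rnorm v == 0) = (v == 0).
Proof.
by rewrite -[in RHS]normr_eq0 normrE_rnorm (inj_eq (@complexI R) _ 0).
Qed.

Lemma rnorm_gt0 v : (0 < rnorm v) = (v != 0).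
Proof. by rewrite lt_def rnorm_eq0 rnorm_ge0 andbT. Qed.

Lemma rnorm0 : rnorm 0 = 0.
Proof. by apply/eqP; rewrite rnorm_eq0. Qed.

Lemma rnormZ (a : R[i]) v : rnorm (a *: v) = normc a * rnorm v.
Proof. by apply: complexI; rewrite rmorphM/= -!normrE_rnorm normrZ. Qed.

Lemma rnormN v : rnorm (- v) = rnorm v.
Proof. by rewrite /rnorm normrN. Qed.

Lemma rnormB u v : rnorm (u - v) = rnorm (v - u).
Proof. by rewrite -rnormN opprB. Qed.

Lemma ler_rnormD u v : rnorm (u + v) <= rnorm u + rnorm v.
Proof. by rewrite -lecR rmorphD/= -!normrE_rnorm ler_normD. Qed.

Lemma ler_rnorm_sum n (F : 'I_n -> V) :
  rnorm (\sum_(k < n) F k) <= \sum_(k < n) rnorm (F k).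
Proof.
elim/big_rec2: _ => [|k y x _ xy]; first by rewrite rnorm0.
by rewrite (le_trans (ler_rnormD _ _))// lerD2l.
Qed.

Lemma normc_nat n : normc (n%:R : R[i]) = n%:R.
Proof. by apply: complexI; rewrite -normrcE normr_nat rmorph_nat. Qed.

Lemma rnormZVn n v : (0 < n)%N ->
  rnorm ((n%:R : R[i])^-1 *: v) = n%:R^-1 * rnorm v.
Proof. by move=> n0; rewrite rnormZ normcV ?normc_nat// pnatr_eq0 -lt0n. Qed.

Lemma linear_continuous_rnormP (S : {linear V -> V}) :
  continuous S <-> exists M : R, forall v, rnorm (S v) <= M * rnorm v.
Proof.
rewrite -linear_bounded_continuous linear_boundedP; split => [/pinfty_ex_gt0|].
  move=> [M M0 SM]; exists (complex.Re M) => v.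
  by rewrite -lecR rmorphM/= (RRe_real (gtr0_real M0)) -!normrE_rnorm.
move=> [M SM]; exists M%:C; split; first by apply/complex_realP; exists M.
move=> r /ltW Mr v; rewrite (le_trans _ (ler_wpM2r (normr_ge0 v) Mr))//.
by rewrite !normrE_rnorm -rmorphM/= lecR.
Qed.

End real_norm.

(** * The operator norm and pointwise bounds *)

Section opnorm.
Context (R : realType) (V : normedModType R[i]).
Implicit Types (S : V -> V) (T : {linear V -> V}).

Lemma opnorm_ge0 S : (0 <= opnorm S)%E.
Proof.
apply: (@le_trans _ _ (complex.Re `|S 0|)%:E).
  by rewrite lee_fin; exact: rnorm_ge0.
by apply: ereal_sup_ubound; exists 0; rewrite //= normr0.
Qed.

Lemma opnorm_le S (c : R) : 0 <= c ->
  (forall v, rnorm (S v) <= c * rnorm v) -> (opnorm S <= c%:E)%E.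
Proof.
move=> c0 Sc; apply: ge_ereal_sup => _ [v /= v1 <-]; rewrite lee_fin.
rewrite (le_trans (Sc v))// ler_piMr//.
by move: v1; rewrite normrE_rnorm -[1]/(1%:C) lecR.
Qed.

(** Homogeneity allows a nonzero [v] to be rescaled to norm 1, where the supremum applies. *)
Lemma ler_opnorm S (c : R) v : (forall a u, S (a *: u) = a *: S u) ->
  (opnorm S <= c%:E)%E -> rnorm (S v) <= c * rnorm v.
Proof.
move=> SZ Sc; have [->|v0] := eqVneq v 0.
  by rewrite -(scale0r 0) SZ !scale0r rnorm0 mulr0.
have rv0 : 0 < rnorm v by rewrite rnorm_gt0.
pose w := (rnorm v)^-1%:C *: v.
have nw : normc (rnorm v)^-1%:C = (rnorm v)^-1.
  by apply: complexI; rewrite -normrcE ger0_norm// lecR invr_ge0 ltW.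
have rw : rnorm w = 1 by rewrite rnormZ nw mulVf ?gt_eqF.
suff : rnorm (S w) <= c.
  by rewrite SZ rnormZ nw mulrC ler_pdivrMr.
rewrite -lee_fin; apply: le_trans Sc; apply: ereal_sup_ubound.
by exists w => //=; rewrite normrE_rnorm rw.
Qed.

End opnorm.

(** * Approximate eigenvalues *)

Section approximate_eigenvalue.
Context (R : realType) (V : normedModType R[i]).
Variable T : {linear V -> V}.

Definition approx_eigenvalue (a : R[i]) := forall e : R, 0 < e ->
  exists2 v, v != 0 & rnorm (T v - a *: v) <= e * rnorm v.

(** A left inverse of [a - T] bounded by [M] would give [|v| <= M |T v - a v|] for all [v], which
    fails for approximate eigenvectors. *)
Lemma approx_eigenvalue_spectrum a : approx_eigenvalue a -> spectrum T a.
Proof.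
move=> aT [S [/linear_continuous_rnormP[M SM] ST _]].
(* The bound [M] is not known to be positive; its maximum with 1 is. *)
have M1 : 0 < Num.max M 1 by rewrite lt_max ltr01 orbT.
have [|v v0 Tv] := aT ((2 * Num.max M 1)^-1).
  by rewrite invr_gt0 mulr_gt0.
have rv0 : 0 < rnorm v by rewrite rnorm_gt0.
have : rnorm v <= 2^-1 * rnorm v.
  rewrite -{1}(ST v) (le_trans (SM _))// rnormB.
  rewrite (@le_trans _ _ (Num.max M 1 * rnorm (T v - a *: v)))//.
    by rewrite ler_wpM2r ?rnorm_ge0// le_max lexx.
  by rewrite -ler_pdivlMl// mulrA -invfM [Num.max _ _ * _]mulrC.
lra.
Qed.

End approximate_eigenvalue.

(** * The unit circle near 1 and roots of unity *)

Section unit_circle.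
Context (R : realType).

(** The point is the Cayley transform [(1 + it) / (1 - it)] with [t = e / 2]. It differs from 1 by
    [ie / (1 - it)], and the denominator has modulus at least 1. *)
Lemma unit_circle_near1 (e : R) : 0 < e ->
  exists a : R[i], [/\ normc a = 1, a != 1 & normc (a - 1) <= e].
Proof.
move=> e0; have t0 : 0 < e / 2 by rewrite divr_gt0.
set t := e / 2 in t0; pose z := 1 +i* t; pose w := 1 -i* t.
have w0 : w != 0 by rewrite eq_complex/= oner_eq0.
have nzw : normc z = normc w by rewrite /z /w /normc sqrrN.
have nw1 : 1 <= normc w.
  rewrite /w /normc sqrrN expr1n -[leLHS]sqrtr1 ler_wsqrtr// lerDl sqr_ge0//.
have nw0 : normc w != 0 by rewrite gt_eqF// (lt_le_trans ltr01).
exists (z / w).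
have zw : z / w - 1 = (0 +i* e) / w.
  rewrite -[X in _ - X](divff w0) -mulrBl; congr (_ / _).
  by apply/eqP; rewrite eq_complex/= subrr eqxx opprK -splitr eqxx.
split.
- by rewrite normcM normcV nzw divff.
- rewrite -subr_eq0 zw mulf_neq0 ?invr_eq0// eq_complex/= negb_and.
  by rewrite (gt_eqF e0) orbT.
- rewrite zw normcM normcV ler_pdivrMr; last by rewrite (lt_le_trans ltr01).
  by rewrite {1}/normc expr0n add0r sqrtr_sqr gtr0_norm// ler_peMr// ltW.
Qed.

Lemma normcX (a : R[i]) k : normc (a ^+ k) = normc a ^+ k.
Proof. by elim: k => [|k IH]; rewrite ?expr0 ?normc1// !exprS normcM IH. Qed.

Lemma normc_sub1X (a : R[i]) k : normc a = 1 ->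
  normc (1 - a ^+ k) <= k%:R * normc (1 - a).
Proof.
move=> a1; elim: k => [|k IH]; first by rewrite expr0 subrr normc0 mul0r.
have -> : 1 - a ^+ k.+1 = (1 - a ^+ k) + a ^+ k * (1 - a).
  by rewrite exprSr; ring.
rewrite (le_trans (le_normcD _ _))// -natr1 mulrDl mul1r lerD// normcM.
by rewrite normcX a1 expr1n mul1r.
Qed.

(** The powers of [a] below [n] sum to 0, so [n] is the sum of the [1 - a ^+ k]. Each of these has
    modulus at most [n |1 - a|], whence [n <= n^2 |1 - a|]. *)
Lemma unity_root_far1 (a : R[i]) n : (0 < n)%N -> a ^+ n = 1 -> a != 1 ->
  n%:R^-1 <= normc (1 - a).
Proof.
move=> n0 an1 a1; have na1 : normc a = 1.
  apply/eqP; rewrite -(@pexpr_eq1 _ _ n) ?normc_ge0//.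
  by rewrite -normcX an1 normc1.
have s0 : \sum_(k < n) a ^+ k = 0.
  have /eqP := subrX1 a n; rewrite an1 subrr eq_sym mulf_eq0 subr_eq0.
  by rewrite (negPf a1) => /eqP.
have nE : (n%:R : R[i]) = \sum_(k < n) (1 - a ^+ k).
  by rewrite sumrB s0 subr0 sumr_const card_ord.
have n0R : (0 : R) < n%:R by rewrite ltr0n.
suff : n%:R <= n%:R * (n%:R * normc (1 - a)).
  by rewrite -{1}[n%:R]mulr1 ler_pM2l// -ler_pdivrMl// mulr1.
rewrite -{1}normc_nat nE.
apply: (@le_trans _ _ (\sum_(k < n) normc (1 - a ^+ k))).
  elim/big_rec2: _ => [|k y x _ xy]; first by rewrite normc0.
  by rewrite (le_trans (le_normcD _ _))// lerD2l.
have -> x : n%:R * x = \sum_(k < n) x :> R.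
  by rewrite mulr_natl sumr_const card_ord.
apply: ler_sum => k _.
rewrite (le_trans (normc_sub1X _ na1))// ler_wpM2r ?normc_ge0// ler_nat.
exact: ltnW.
Qed.

Lemma nbhs_normc (a : R[i]) (A : set R[i]) :
  nbhs (a : R[i]^o) A <->
  exists2 e : R, 0 < e & forall b, normc (a - b) < e -> A b.
Proof.
split=> [/nbhs_ballP[e /= e0 eA]|[e e0 eA]].
  (* A positive element of [R[i]] is real, so the radius of the ball comes from [R]. *)
  have eR : (complex.Re e)%:C = e by rewrite RRe_real// gtr0_real.
  exists (complex.Re e); first by rewrite -ltcR eR.
  by move=> b ab; apply: eA; rewrite -ball_normE/= normrcE -eR ltcR.
apply/nbhs_ballP; exists e%:C; first by rewrite /= ltcR.
by move=> b; rewrite -ball_normE/= normrcE ltcR; exact: eA.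
Qed.

End unit_circle.

(** * Cesaro means and spectrum of a linear isometry *)

Section isometry.
Context (R : realType) (V : normedModType R[i]).
Variable T : {linear V -> V}.
Hypothesis isoT : forall v, `|T v| = `|v|.
Implicit Types u v : V.

Lemma rnorm_iter k v : rnorm (iter k T v) = rnorm v.
Proof. by elim: k => //= k <-; rewrite /rnorm isoT. Qed.

Lemma iter_linearD k u v : iter k T (u + v) = iter k T u + iter k T v.
Proof. by elim: k => //= k ->; rewrite linearD. Qed.

Lemma iter_linearZ k a v : iter k T (a *: v) = a *: iter k T v.
Proof. by elim: k => //= k ->; rewrite linearZ. Qed.

Lemma cesaro_linear n : linear (cesaro_mean T n).
Proof.
move=> a u v; rewrite /cesaro_mean scalerA mulrC -scalerA -scalerDr.
congr (_ *: _); rewrite scaler_sumr -big_split/=; apply: eq_bigr => k _.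
by rewrite iter_linearD iter_linearZ.
Qed.

HB.instance Definition _ n :=
  GRing.isLinear.Build R[i] V V _ (cesaro_mean T n) (cesaro_linear n).

(** By isometry [v - T^k v] has norm at most [k |T v - v|]; averaging over [k < n] gives the
    bound. *)
Lemma rnorm_cesaro_sub n v : (0 < n)%N ->
  rnorm (v - cesaro_mean T n v) <= n%:R * rnorm (T v - v).
Proof.
move=> n0; have kv k : rnorm (v - iter k T v) <= k%:R * rnorm (T v - v).
  elim: k => [|k IH]; first by rewrite subrr rnorm0 mul0r.
  rewrite iterSr (_ : v - _ = (v - iter k T v) + iter k T (v - T v)).
    rewrite (le_trans (ler_rnormD _ _))// -natr1 mulrDl mul1r lerD//.
    by rewrite rnorm_iter rnormB.
  have -> : v - T v = v + (-1) *: T v by rewrite scaleN1r.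
  by rewrite iter_linearD iter_linearZ scaleN1r addrA subrK.
have n0C : (n%:R : R[i]) != 0 by rewrite pnatr_eq0 -lt0n.
have -> : v - cesaro_mean T n v = n%:R^-1 *: \sum_(k < n) (v - iter k T v).
  rewrite sumrB scalerBr sumr_const card_ord -(scaler_nat n v) scalerA.
  by rewrite mulVf// scale1r.
rewrite rnormZVn// ler_pdivrMl ?ltr0n//.
rewrite (le_trans (ler_rnorm_sum _))//.
rewrite [leRHS](_ : _ = \sum_(k < n) n%:R * rnorm (T v - v)).
2: by rewrite [LHS]mulr_natl sumr_const card_ord.
apply: ler_sum => k _; rewrite (le_trans (kv _))//.
by rewrite ler_wpM2r ?rnorm_ge0// ler_nat ltnW.
Qed.

(** The difference of the two sums telescopes to [T^n v - v]. *)
Lemma rnorm_cesaro_comp n v : (0 < n)%N ->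
  rnorm (cesaro_mean T n (T v) - cesaro_mean T n v) <= n%:R^-1 * (2 * rnorm v).
Proof.
move=> n0; rewrite /cesaro_mean -scalerBr rnormZVn//.
rewrite ler_pM2l ?invr_gt0 ?ltr0n//.
rewrite -sumrB.
under eq_bigr do rewrite -iterSr.
rewrite -(big_mkord xpredT (fun k => iter k.+1 T v - iter k T v)).
rewrite telescope_sumr// (le_trans (ler_rnormD _ _))// rnormN !rnorm_iter.
by rewrite mulr_natl mulr2n.
Qed.

Lemma cesaro_cvg_norm (P : {linear V -> V}) (e : R) : 0 < e ->
  opnorm (cesaro_mean T n \- P) @[n --> \oo] --> 0%E ->
  \forall n \near \oo, forall v, rnorm (cesaro_mean T n v - P v) <= e * rnorm v.
Proof.
move=> e0 /fine_cvgP[fA] /cvgrPdist_le/(_ _ e0) cA.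
apply: filterS2 fA cA => n fn cn v.
apply: (@ler_opnorm _ _ (cesaro_mean T n \- P)).
  by move=> a u /=; rewrite linearZ linearZ scalerBr.
rewrite -(fineK fn) lee_fin; move: cn; rewrite sub0r normrN.
exact: le_trans (ler_norm _).
Qed.

(* The mean of an approximate eigenvector for a near 1 stays close to it, while
   its image under the limit P is small, because P T = P forces
   (1 - a) P v = P (T v - a v). *)
Lemma approx_eigenvalues_not_uniformly_ergodic :
  (forall a, normc a = 1 -> approx_eigenvalue T a) -> ~ uniformly_ergodic T.
Proof.
move=> aT [P cP AP].
have PT v : P (T v) = P v.
  apply/eqP; rewrite -subr_eq0 -rnorm_eq0 eq_le rnorm_ge0 andbT.
  apply/ler_addgt0Pr => e e0; rewrite add0r.
  (* Two approximation errors [c |v|] and a telescoping error [2 c |v|] add up to at most [e]; the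
     added 1 keeps the denominator positive when [v] is 0. *)
  pose c : R := e / (4 * (rnorm v + 1)).
  have v1 : 0 < rnorm v + 1 by rewrite ltr_wpDl ?rnorm_ge0.
  have c0 : 0 < c by rewrite divr_gt0 ?mulr_gt0.
  near \oo => n.
  have n0 : (0 < n)%N by near: n; exists 1%N.
  have cn : n%:R^-1 <= c.
    rewrite invf_ple ?posrE ?ltr0n//; near: n; exact: nbhs_infty_ger.
  have An : forall v, rnorm (cesaro_mean T n v - P v) <= c * rnorm v.
    by near: n; exact: cesaro_cvg_norm.
  have h1 := An v; have h2 := An (T v).
  rewrite {2}/rnorm isoT -/(rnorm v) in h2.
  have h3 := rnorm_cesaro_comp v n0.
  have h4 : rnorm (P (T v) - P v) <= rnorm (cesaro_mean T n (T v) - P (T v)) +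
     rnorm (cesaro_mean T n v - P v) +
     rnorm (cesaro_mean T n (T v) - cesaro_mean T n v).
    rewrite (rnormB (cesaro_mean T n (T v)) (P _)).
    rewrite [X in rnorm X](_ : _ = P (T v) - cesaro_mean T n (T v) +
      (cesaro_mean T n v - P v) + (cesaro_mean T n (T v) - cesaro_mean T n v)).
      by rewrite !(le_trans (ler_rnormD _ _))// lerD2r ler_rnormD.
    by rewrite addrAC !subrKA.
  have h5 : n%:R^-1 * (2 * rnorm v) <= c * (2 * rnorm v).
    by rewrite ler_wpM2r// mulr_ge0 ?rnorm_ge0.
  have h6 : e = c * (4 * (rnorm v + 1)) by rewrite divfK// gt_eqF// mulr_gt0.
  rewrite (le_trans h4)// h6; nra.
(* For this fixed [n] and a suitable [v], the vectors [v - A_n v], [A_n v - P v] and [P v] all have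
   norm at most [|v| / 4], which contradicts the triangle inequality. *)
near \oo => n.
have n0 : (0 < n)%N by near: n; exists 1%N.
have n0R : (0 : R) < n%:R by rewrite ltr0n.
have An : forall v, rnorm (cesaro_mean T n v - P v) <= 4^-1 * rnorm v.
  by near: n; exact: cesaro_cvg_norm.
have /linear_continuous_rnormP[M PM] := cP.
pose K := Num.max M 1.
have K0 : 0 < K by rewrite lt_max ltr01 orbT.
have PK v : rnorm (P v) <= K * rnorm v.
  by rewrite (le_trans (PM v))// ler_wpM2r ?rnorm_ge0// le_max lexx.
(* If [|T v - a v| <= |v| / (8n)] and [|a - 1| <= 1 / (8n)], then [n |T v - v| <= |v| / 4]. *)
have d0 : (0 : R) < (8 * n%:R)^-1 by rewrite invr_gt0 mulr_gt0.
have [a [a1 an1 a1d]] := unit_circle_near1 d0.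
have na0 : 0 < normc (1 - a).
  rewrite lt_def normc_ge0 andbT; apply: contra_neq an1 => /eq0_normc/eqP.
  by rewrite subr_eq0 => /eqP.
(* The second bound gives [K d <= |1 - a| / 4], so that dividing [(1 - a) P v = P (T v - a v)] by
   [1 - a] leaves [|P v| <= |v| / 4]. *)
pose d := Num.min (8 * n%:R)^-1 (normc (1 - a) / (4 * K)).
have [|v v0 Tv] := aT _ a1 d.
  by rewrite lt_min d0 divr_gt0// mulr_gt0.
have rv0 : 0 < rnorm v by rewrite rnorm_gt0.
have dn : d <= (8 * n%:R)^-1 by rewrite ge_min lexx.
have da : d <= normc (1 - a) / (4 * K) by rewrite ge_min lexx orbT.
have Tv1 : rnorm (T v - v) <= 2 * (8 * n%:R)^-1 * rnorm v.
  have -> : T v - v = (T v - a *: v) + (a - 1) *: v.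
    by rewrite scalerBl scale1r subrKA.
  rewrite (le_trans (ler_rnormD _ _))// rnormZ; nra.
have h1 : rnorm (v - cesaro_mean T n v) <= 4^-1 * rnorm v.
  rewrite (le_trans (rnorm_cesaro_sub v n0))//.
  rewrite (le_trans (ler_wpM2l (ltW n0R) Tv1))// mulrA ler_wpM2r ?rnorm_ge0//.
  rewrite le_eqVlt; apply/orP; left; apply/eqP; field.
  by rewrite gt_eqF.
have h2 : rnorm (P v) <= 4^-1 * rnorm v.
  rewrite -(ler_pM2l na0) -rnormZ.
  have -> : (1 - a) *: P v = P (T v - a *: v).
    by rewrite linearB linearZ PT scalerBl scale1r.
  rewrite (le_trans (PK _))// (le_trans (ler_wpM2l (ltW K0) Tv))//.
  rewrite !mulrA ler_wpM2r ?rnorm_ge0// (le_trans (ler_wpM2l (ltW K0) da))//.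
  rewrite le_eqVlt; apply/orP; left; apply/eqP; field.
  by rewrite gt_eqF.
have : rnorm v <= rnorm (v - cesaro_mean T n v) +
    rnorm (cesaro_mean T n v - P v) + rnorm (P v).
  rewrite -[X in rnorm X <= _](subrK (P v)) (le_trans (ler_rnormD _ _))//.
  by rewrite lerD2r -[X in rnorm X <= _](subrKA (cesaro_mean T n v)) ler_rnormD.
have := An v; lra.
Unshelve. all: by end_near. Qed.

(** Every neighbourhood of 1 contains another point of the unit circle, and that point is in the
    spectrum. *)
Lemma approx_eigenvalues_not_isolated :
  (forall a, normc a = 1 -> approx_eigenvalue T a) ->
  ~ isolated_in_spectrum T 1.
Proof.
move=> aT [_ [A /nbhs_normc[e e0 eA] A1]].
have [|a [a1 an1 a1e]] := @unit_circle_near1 R (e / 2).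
  by rewrite divr_gt0.
have : (A `&` spectrum T) a.
  split; last exact/approx_eigenvalue_spectrum/aT.
  apply: eA; rewrite -normcN opprB (le_lt_trans a1e)//.
  by rewrite ltr_pdivrMr// ltr_pMr// ltr1n.
by rewrite A1 /= => /eqP; rewrite (negPf an1).
Qed.

(** * Isometries with [T^n = 1] *)

Section periodic.
Variable n : nat.
Hypothesis n0 : (0 < n)%N.
Hypothesis Tn : forall v, iter n T v = v.

(** This inverts [a - T], by the factorization of [a^n - T^n] when [T^n = 1]. If [a ^+ n = 1] the
    scalar inverse defaults to 0 and the map is zero. *)
Definition periodic_resolvent (a : R[i]) : V -> V :=
  fun v => (a ^+ n - 1)^-1 *: \sum_(k < n) a ^+ (n - k.+1) *: iter k T v.

Lemma periodic_resolvent_linear a : linear (periodic_resolvent a).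
Proof.
move=> b u v; rewrite /periodic_resolvent scalerA mulrC -scalerA -scalerDr.
congr (_ *: _); rewrite scaler_sumr -big_split/=; apply: eq_bigr => k _.
by rewrite iter_linearD iter_linearZ scalerDr !scalerA [b * _]mulrC.
Qed.

HB.instance Definition _ a := GRing.isLinear.Build R[i] V V _
  (periodic_resolvent a) (periodic_resolvent_linear a).

Lemma periodic_resolvent_continuous a : continuous (periodic_resolvent a).
Proof.
apply/linear_continuous_rnormP; exists (normc (a ^+ n - 1)^-1 *
  \sum_(k < n) normc (a ^+ (n - k.+1))) => v.
rewrite rnormZ -mulrA ler_wpM2l ?normc_ge0// mulr_suml.
rewrite (le_trans (ler_rnorm_sum _))//; apply: ler_sum => k _.
by rewrite rnormZ rnorm_iter.
Qed.

Lemma periodic_spectrum a : spectrum T a -> a ^+ n = 1.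
Proof.
apply: contra_notP => /eqP; rewrite -subr_eq0 => an1.
have SK v : periodic_resolvent a (a *: v - T v) = v.
  rewrite /periodic_resolvent.
  rewrite (_ : \sum_(k < n) _ = (a ^+ n - 1) *: v).
    by rewrite scalerA mulVf// scale1r.
  (* Each term is a difference of consecutive values of [a^(n-k) T^k v], and the sum telescopes to
     [a^n v - T^n v]. *)
  rewrite (eq_bigr (fun k : 'I_n => a ^+ (n - k) *: iter k T v -
      a ^+ (n - k.+1) *: iter k.+1 T v)); last first.
    move=> k _; rewrite -scaleN1r iter_linearD !iter_linearZ -iterSr scaleN1r.
    by rewrite scalerBr scalerA -exprSr -subSn// ltnW.
  rewrite -(big_mkord xpredT (fun k => a ^+ (n - k) *: iter k T v -
      a ^+ (n - k.+1) *: iter k.+1 T v)).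
  under eq_bigr do rewrite -opprB.
  rewrite sumrN (telescope_sumr (fun k => a ^+ (n - k) *: iter k T v))//.
  by rewrite subnn expr0 scale1r Tn subn0 opprB scalerBl scale1r.
exists (periodic_resolvent a); split=> //.
  exact: periodic_resolvent_continuous.
(* The resolvent commutes with [T], so the left inverse is also a right inverse. *)
move=> v; have TS : T (periodic_resolvent a v) = periodic_resolvent a (T v).
  rewrite /periodic_resolvent linearZ linear_sum; congr (_ *: _).
  by apply: eq_bigr => k _; rewrite linearZ/= -iterS iterSr.
by rewrite TS -[RHS]SK [RHS]linearB [in RHS]linearZ.
Qed.

(** The fixed vector puts 1 in the spectrum; any other spectral point is an [n]-th root of unity, at
    distance at least [1 / n] from 1. *)
Lemma periodic_isolated v : v != 0 -> T v = v -> isolated_in_spectrum T 1.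
Proof.
move=> v0 Tv; have sT1 : spectrum T 1.
  apply: approx_eigenvalue_spectrum => e e0; exists v => //.
  by rewrite scale1r Tv subrr rnorm0 mulr_ge0 ?rnorm_ge0// ltW.
split; first exact/mem_set.
exists [set a | normc (1 - a) < n%:R^-1].
  by apply/nbhs_normc; exists n%:R^-1; rewrite ?invr_gt0 ?ltr0n.
apply/seteqP; split => [a [/= a1 /periodic_spectrum an1]|_ ->]; last first.
  split=> //; change (normc (1 - 1 : R[i]) < n%:R^-1).
  by rewrite subrr normc0 invr_gt0 ltr0n.
apply/eqP/negPn/negP => aN1.
by have := unity_root_far1 n0 an1 aN1; rewrite leNgt a1.
Qed.

(** The vector [D k], which is [k (A_k - A_n) v], is periodic in [k] with period [n], because
    [D n = 0] and [T^n = 1]. Hence it is bounded by its values for [k < n], sums of fewer than [n]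
    terms of norm at most [2 |v|]. *)
Lemma rnorm_cesaro_periodic m v : (0 < m)%N ->
  rnorm (cesaro_mean T m v - cesaro_mean T n v) <= (2 * n)%:R / m%:R * rnorm v.
Proof.
move=> m0.
set w := cesaro_mean T n v; pose D k := \sum_(i < k) (iter i T v - w).
have rw : rnorm w <= rnorm v.
  rewrite rnormZVn// ler_pdivrMl ?ltr0n// (le_trans (ler_rnorm_sum _))//.
  under eq_bigr do rewrite rnorm_iter.
  by rewrite sumr_const card_ord mulr_natl.
have DE k : (0 < k)%N -> D k = k%:R *: (cesaro_mean T k v - w).
  move=> k0; rewrite /D sumrB sumr_const card_ord scalerBr scalerA divff.
    by rewrite scale1r scaler_nat.
  by rewrite pnatr_eq0 -lt0n.
have DnD k : D (n + k)%N = D k.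
  rewrite /D big_split_ord /= -/(D n) (DE n)// subrr scaler0 add0r.
  by apply: eq_bigr => i _; rewrite addnC iterD Tn.
have Dle k : rnorm (D k) <= (2 * n)%:R * rnorm v.
  elim/ltn_ind: k => k IH; have [kn|nk] := ltnP k n; last first.
    by rewrite -(subnKC nk) DnD IH// -subn_gt0 subKn.
  rewrite (le_trans (ler_rnorm_sum _))//.
  apply: (@le_trans _ _ (\sum_(i < k) 2 * rnorm v)).
    apply: ler_sum => i _; rewrite (le_trans (ler_rnormD _ _))// rnormN.
    by rewrite rnorm_iter mulr_natl mulr2n lerD2l.
  rewrite sumr_const card_ord -[leLHS]mulr_natl natrM mulrA.
  by rewrite ler_wpM2r ?rnorm_ge0// mulrC ler_pM2l// ler_nat ltnW.
have m0R : (0 : R) < m%:R by rewrite ltr0n.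
by rewrite mulrAC ler_pdivlMr// mulrC -(normc_nat R m) -rnormZ -DE.
Qed.

Lemma periodic_uniformly_ergodic : uniformly_ergodic T.
Proof.
exists (cesaro_mean T n).
  apply/linear_continuous_rnormP; exists 1 => v; rewrite mul1r rnormZVn//.
  rewrite ler_pdivrMl ?ltr0n// (le_trans (ler_rnorm_sum _))//.
  under eq_bigr do rewrite rnorm_iter.
  by rewrite sumr_const card_ord mulr_natl.
apply: (@squeeze_cvge _ _ _ _ (cst 0%E) _
  (fun m => ((2 * n)%:R / m%:R)%:E)); last 2 first.
- exact: cvg_cst.
- apply/cvg_EFin; first by apply: nearW.
  rewrite -[X in _ --> X](mulr0 (2 * n)%:R); apply: cvgMl_tmp.
  by apply/gtr0_cvgV0; [exists 1%N => //= k; rewrite ltr0n|exact: cvgr_idn].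
near=> m; have m0 : (0 < m)%N by near: m; exists 1%N.
rewrite opnorm_ge0/=; apply: opnorm_le; first by rewrite divr_ge0.
by move=> v; exact: rnorm_cesaro_periodic.
Unshelve. all: by end_near. Qed.

End periodic.
End isometry.

(** * Periodicity modulo null sets, and towers *)

Section iterates.
Context (R : realType) (d : measure_display) (X : measurableType d).
Context (mu : probability X R) (phi : X -> X).
Hypothesis hphi : measure_preserving mu phi.

Lemma measure_preserving_iter k : measure_preserving mu (iter k phi).
Proof.
have [mphi phimu] := hphi; elim: k => [|k [mk kmu]].
  by split=> //; exact: measurable_id.
split; first exact: (measurableT_comp mphi mk).
move=> A mA; rewrite -[LHS]/(mu (iter k phi @^-1` (phi @^-1` A))) kmu ?phimu//.
by rewrite -[X in measurable X]setTI; exact: mphi.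
Qed.

Lemma measurable_preimage_iter k A :
  measurable A -> measurable (iter k phi @^-1` A).
Proof.
by move=> mA; rewrite -[X in measurable X]setTI;
  exact: (measure_preserving_iter k).1.
Qed.

Lemma measure_preimage_iter k A :
  measurable A -> mu (iter k phi @^-1` A) = mu A.
Proof. exact: (measure_preserving_iter k).2. Qed.

(* Periodicity at the level of the sigma-algebra, which is all that the
   composition operator sees. *)
Definition set_periodic n :=
  forall A, measurable A -> mu (A `\` iter n phi @^-1` A) = 0%E.

Lemma mu_periodic_set_periodic :
  mu_periodic mu phi -> exists2 n, (0 < n)%N & set_periodic n.
Proof.
move=> [n n0 [N [mN N0 phiN]]]; exists n => // A mA.
apply: (subset_measure0 _ mN _ N0) => [|x [Ax nAx]].
  by apply: measurableD => //; exact: measurable_preimage_iter.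
by apply: phiN => /= nx; apply: nAx; rewrite /preimage/= nx.
Qed.

(** [set_periodic] for [E i] gives one implication and for its complement the other; the exceptional
    set is a countable union of null sets. *)
Lemma set_periodic_ae n (E : nat -> set X) : set_periodic n ->
  (forall i, measurable (E i)) ->
  {ae mu, forall x, forall i, E i (iter n phi x) <-> E i x}.
Proof.
move=> nP mE; pose D A := A `\` iter n phi @^-1` A.
have D0 A : measurable A -> mu.-negligible (D A).
  move=> mA; exists (D A); split=> //; last exact: nP.
  by apply: measurableD => //; exact: measurable_preimage_iter.
apply: (@negligibleS _ _ _ mu (\bigcup_i (D (E i) `|` D (~` E i)))).
  move=> x /=; apply: contra_notP => DEx i.
  have nD A : D A `<=` D (E i) `|` D (~` E i) -> ~ D A x.
    by move=> AE Ax; apply: DEx; exists i => //; exact: AE.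
  split=> Ex.
  - have := nD (~` E i) (@subsetUr _ _ _).
    by apply: contra_notP => nEx; split=> //; exact.
  - have := nD (E i) (@subsetUl _ _ _).
    by apply: contra_notP => nEx; split.
apply: negligible_bigcup => i.
by apply: negligibleU; apply: D0 => //; exact: measurableC.
Qed.

(** Almost every [x] and its [n]-th iterate lie in the same sets [E i]. Both also avoid the null set
    where separation may fail, the iterate because the measure is preserved. *)
Lemma set_periodic_mu_periodic n : countably_separated mu -> (0 < n)%N ->
  set_periodic n -> mu_periodic mu phi.
Proof.
move=> [E mE [N [M [mM M0 NM]] EN]] n0 nP; exists n => //.
have aM : {ae mu, forall x, ~ M x}.
  by exists M; split=> // x /contrapT.
have aM' : {ae mu, forall x, ~ M (iter n phi x)}.
  exists (iter n phi @^-1` M); split=> //.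
  - exact: measurable_preimage_iter.
  - by rewrite measure_preimage_iter.
  - by move=> x /contrapT.
apply: filterS3 (set_periodic_ae nP mE) aM aM' => x Ex Mx Mnx.
by apply: EN => [/NM|/NM|i] //; exact: Ex.
Qed.

(** A real function is determined by its sublevel sets at rational heights, a countable family. *)
Lemma set_periodic_measurable_fun n (h : X -> R) : set_periodic n ->
  measurable_fun setT h -> {ae mu, forall x, h (iter n phi x) = h x}.
Proof.
(* [unpickle] enumerates the rationals, with value 0 at indices that encode none. *)
move=> nP mh; pose E i := h @^-1` [set r | r < ratr (odflt 0 (unpickle i))].
have mE i : measurable (E i).
  by rewrite -[X in measurable X]setTI /E -set_itvNyo; exact: mh.
apply: filterS (set_periodic_ae nP mE) => x Ex.
have Eq (q : rat) : h (iter n phi x) < ratr q <-> h x < ratr q.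
  by have := Ex (pickle q); rewrite /E /preimage/= pickleK.
apply/eqP; rewrite eq_le !leNgt; apply/andP; split; apply/negP.
- move=> /rat_in_itvoo[q]; rewrite in_itv/= => /andP[/Eq + hq].
  by rewrite ltNge (ltW hq).
- move=> /rat_in_itvoo[q]; rewrite in_itv/= => /andP[/Eq + hq].
  by rewrite ltNge (ltW hq).
Qed.

(** A point of [C] outside [C] at time [(m + 1) k] is either outside at time [m k], or inside then
    and outside [k] steps later. The second case is a preimage of a null set. *)
Lemma measure_setD_iterM k m C : measurable C ->
  mu (C `\` iter k phi @^-1` C) = 0%E ->
  mu (C `\` iter (m * k) phi @^-1` C) = 0%E.
Proof.
move=> mC kC; have mD j : measurable (C `\` iter j phi @^-1` C).
  by apply: measurableD => //; exact: measurable_preimage_iter.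
elim: m => [|m IH]; first by rewrite mul0n setDv measure0.
have mDk := measurable_preimage_iter (m * k) (mD k).
apply: (subset_measure0 (mD _) (measurableU _ _ (mD (m * k)%N) mDk)).
  move=> x [Cx nCx]; have [Cmx|] := pselect (C (iter (m * k) phi x)).
    by right; split=> //; rewrite /preimage/= -iterD -mulSn.
  by left.
apply: (eq_trans (measureU0 (mD _) mDk _)) => //.
exact: (eq_trans (measure_preimage_iter _ (mD k)) kC).
Qed.

(* Almost every point may be periodic, with unbounded periods, so it is a set
   displaced by the N!-th iterate which is thinned out: no part of it is
   invariant under an iterate of order k <= N, as k divides N!. *)
Lemma aperiodic_tower : (forall n, (0 < n)%N -> ~ set_periodic n) ->
  forall N, exists B, [/\ measurable B, (0 < mu B)%E &
    forall k, (0 < k <= N)%N -> B `&` iter k phi @^-1` B = set0].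
Proof.
move=> aper N; have [A [mA A0]] : exists A, measurable A /\
    mu (A `\` iter N`! phi @^-1` A) <> 0%E.
  apply: contrapT => nA; apply: (aper _ (fact_gt0 N)) => A mA.
  by apply: contrapT => A0; apply: nA; exists A.
(* Thinning proceeds one return time at a time and stays inside the displaced part of [A]. *)
suff H j : (j <= N)%N -> exists B, [/\ measurable B, (0 < mu B)%E,
    B `<=` A `\` iter N`! phi @^-1` A &
    forall k, (0 < k <= j)%N -> B `&` iter k phi @^-1` B = set0].
  by have [B [mB B0 _ Bk]] := H _ (leqnn N); exists B.
have mD C k : measurable C -> measurable (C `\` iter k phi @^-1` C).
  by move=> mC; apply: measurableD => //; exact: measurable_preimage_iter.
elim: j => [_|j IH jN].
  exists (A `\` iter N`! phi @^-1` A); split=> //; first exact: mD.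
    by rewrite lt0e measure_ge0 andbT; exact/eqP.
  by case.
have [B [mB B0 BA Bk]] := IH (ltnW jN).
exists (B `\` iter j.+1 phi @^-1` B); split=> //; first exact: mD.
(* If the thinned set were null, almost all of [B] would be in [B] again at time [N!]. But points of
   [B] are then outside [A], so [B] itself would be null. *)
- rewrite lt0e measure_ge0 andbT; apply/eqP => BD.
  have /dvdnP[m Nm] : (j.+1 %| N`!)%N by rewrite dvdn_fact.
  have := measure_setD_iterM m mB BD; rewrite -Nm.
  rewrite setDE (setIidl _) => [B00|x Bx /= Bnx].
    by rewrite B00 ltxx in B0.
  by have [_] := BA _ Bx; apply; have [] := BA _ Bnx.
- by move=> x [/BA].
- move=> k /andP[k0]; rewrite leq_eqVlt => /predU1P[->|kj].
    by apply/seteqP; split=> // x [[Bx nBx] [Bjx _]].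
  apply/seteqP; split=> // x [[Bx _] [Bkx _]].
  by rewrite -(Bk k) ?k0.
Qed.

(** The [i]-th iterate sends a common point of levels [i < j] into [B] and its preimage of order
    [j - i]. *)
Lemma tower_disjoint B N :
  (forall k, (0 < k <= N)%N -> B `&` iter k phi @^-1` B = set0) ->
  trivIset [set k | (k <= N)%N] (fun k => iter k phi @^-1` B).
Proof.
move=> Bk; suff dis i j : (j <= N)%N -> (i < j)%N ->
    iter i phi @^-1` B `&` iter j phi @^-1` B = set0.
  apply/trivIsetP => i j /= iN jN; rewrite neq_ltn => /orP[|]; first exact: dis.
  by rewrite setIC; exact: dis.
move=> jN ij; apply/seteqP; split=> // x [Bix Bjx].
change (set0 (iter i phi x)).
rewrite -(Bk (j - i)%N); last by rewrite subn_gt0 ij (leq_trans (leq_subr _ _)).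
by split=> //; rewrite /preimage/= -iterD subnK// ltnW.
Qed.

Lemma measure_tower B N : measurable B ->
  (forall k, (0 < k <= N)%N -> B `&` iter k phi @^-1` B = set0) ->
  mu (\big[setU/set0]_(k < N) (iter k phi @^-1` B)) = (N%:R%:E * mu B)%E.
Proof.
move=> mB Bk; rewrite (measure_bigsetU_ord _ xpredT).
- rewrite (eq_bigr (fun=> mu B)).
    by rewrite sumr_const card_ord mule_natl.
  by move=> k _; exact: measure_preimage_iter.
- by move=> i; exact: measurable_preimage_iter.
apply/trivIsetP => i j _ _ ij.
by apply: (trivIsetP.1 (tower_disjoint Bk)) => //=; exact: ltnW.
Qed.

End iterates.

(** * Norms of indicators and of functions with the same modulus *)

Section indicators.
Context (R : realType) (d : measure_display) (X : measurableType d).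
Context (mu : probability X R) (p : R) (p1 : 1 <= p).
Local Notation Lp := (cLspace mu p1).

(** Only the modulus is prescribed, so as to cover sums of unimodular multiples of indicators of
    disjoint sets. *)
Lemma cLnorm_indic (f : X -> R[i]) (U : set X) : measurable U ->
  (forall x, normc (f x) = \1_U x) ->
  cLnorm mu p f = ((fine (mu U)) `^ p^-1)%:E.
Proof.
move=> mU fU; have p0 : 0 < p by rewrite (lt_le_trans ltr01).
rewrite cLnormE -poweR_EFin fineK ?fin_num_measure//; congr (_ `^ _)%E.
rewrite -[in RHS](setIT U) -integral_indic//; apply: eq_integral => x _.
rewrite fU indicE; case: (x \in U); first by rewrite powR1.
by rewrite powR0// gt_eqF.
Qed.

Lemma rnorm_indic (f : cLfunType mu p1) (U : set X) : measurable U ->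
  (forall x, normc (f x) = \1_U x) ->
  rnorm (\pi_Lp f) = fine (mu U) `^ p^-1.
Proof. by move=> mU fU; rewrite /rnorm cLspace_normE (cLnorm_indic mU fU). Qed.

Lemma normc_indic (U : set X) x : normc (\1_U x)%:C = \1_U x :> R.
Proof. by rewrite /normc/= expr0n addr0 sqrtr_sqr ger0_norm. Qed.

Lemma indic_cLfun (U : set X) : measurable U ->
  (fun x => (\1_U x)%:C) \in cLfun mu p1.
Proof.
move=> mU; rewrite inE/=; split.
  by split; [exact: measurable_indic|exact: measurable_cst].
by rewrite (cLnorm_indic mU (normc_indic U)) ltry.
Qed.

Definition cindic (U : set X) (mU : measurable U) : cLfunType mu p1 :=
  CLfun (indic_cLfun mU).

Lemma rnorm_cindic (U : set X) (mU : measurable U) :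
  rnorm (\pi_Lp (cindic mU)) = fine (mu U) `^ p^-1.
Proof. exact/rnorm_indic/normc_indic. Qed.

End indicators.

(** * The composition operator: periodic and aperiodic cases *)

Section koopman_operator.
Context (R : realType) (d : measure_display) (X : measurableType d).
Context (mu : probability X R) (phi : X -> X).
Hypothesis hphi : measure_preserving mu phi.
Variables (p : R) (p1 : 1 <= p).
Local Notation Lp := (cLspace mu p1).
Local Notation T := (koopman hphi p1).

Lemma iter_koopman k (f : cLfunType mu p1) :
  iter k T (\pi_Lp f) =
  \pi_Lp (CLfun (cLfun_comp (measure_preserving_iter hphi k) f)).
Proof.
elim: k => [|k IH]; first by congr (\pi_Lp _); exact/val_inj.
rewrite iterS IH /koopman/= koopmanE; congr (\pi_Lp _); apply/val_inj/funext.
by move=> x /=; rewrite -iterSr.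
Qed.

Lemma set_periodic_koopman n u : set_periodic mu phi n -> iter n T u = u.
Proof.
move=> nP; elim/quotW: u => f; rewrite iter_koopman; apply/cLspace_eqP => /=.
have [[mRe mIm] _] := cLfunTypeP f.
apply: filterS2 (set_periodic_measurable_fun hphi nP mRe)
  (set_periodic_measurable_fun hphi nP mIm) => x.
by case: (f x) (f (iter n phi x)) => [a b] [a' b'] /= -> ->.
Qed.

(** The constant function 1 is invariant, and it is nonzero because [mu] has total mass 1. *)
Lemma koopman_fixed_vector : exists2 u : Lp, u != 0 & T u = u.
Proof.
exists (\pi_Lp (cindic mu p1 measurableT)).
  rewrite -rnorm_gt0 rnorm_cindic probability_setT/=.
  by rewrite powR1.
rewrite /koopman/= koopmanE; congr (\pi_Lp _); apply/val_inj/funext.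
by move=> x /=; rewrite !indicT.
Qed.

(* On a tower with base B, the operator shifts the indicators of its levels, so
   that a truncated geometric series of them is an approximate eigenvector. *)
Lemma koopman_tower_vector (a : R[i]) N B : normc a = 1 -> measurable B ->
  (forall k, (0 < k <= N)%N -> B `&` iter k phi @^-1` B = set0) ->
  exists v : Lp, rnorm v = (N%:R * fine (mu B)) `^ p^-1 /\
    rnorm (T v - a *: v) <= 2 * fine (mu B) `^ p^-1.
Proof.
move=> a1 mB Bk; have a0 : a != 0.
  by apply: contra_eq_neq a1 => ->; rewrite normc0 eq_sym oner_neq0.
have na k : normc (a^-1 ^+ k) = 1 by rewrite normcX normcV// a1 invr1 expr1n.
pose f := cindic mu p1 mB; pose u := \pi_Lp f.
have ru k : rnorm (iter k T u) = fine (mu B) `^ p^-1.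
  by rewrite (rnorm_iter (norm_koopman hphi (p1 := p1))) rnorm_cindic.
(* With these coefficients [T v - a v] telescopes to two end terms, each of norm [mu(B)^(1/p)]. *)
exists (\sum_(k < N) a^-1 ^+ k *: iter k T u); split; last first.
  rewrite (_ : _ - _ = a * a^-1 ^+ N *: iter N T u - a *: u).
    rewrite (le_trans (ler_rnormD _ _))// rnormN !rnormZ normcM na a1 !mul1r.
    by rewrite mulr_natl mulr2n (ru 0%N) ru.
  pose g k := (a * a^-1 ^+ k) *: iter k T u.
  rewrite [RHS](_ : _ = g N - g 0%N); last by rewrite /g expr0 mulr1.
  rewrite -(telescope_sumr g)// big_mkord linear_sum scaler_sumr -sumrB.
  apply: eq_bigr => k _; rewrite linearZ/= scalerA /g exprS mulrA divff//.
  by rewrite mul1r.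
(* The levels are disjoint, so at each point at most one term of [F] is nonzero; hence the modulus
   of [F] is the indicator of the union [U] of the levels. *)
pose F := \sum_(k < N) a^-1 ^+ k *:
  CLfun (cLfun_comp (measure_preserving_iter hphi k) f).
have -> : \sum_(k < N) a^-1 ^+ k *: iter k T u = \pi_Lp F.
  rewrite /F; elim/big_rec2: _ => [|k y x _ ->].
    by rewrite (raddf0 (\pi_(Quotient.quot (cLnull (p1 := p1))))).
  by rewrite cLspace_piD cLspace_piZ iter_koopman.
have FE x : F x = \sum_(k < N) a^-1 ^+ k * (\1_B (iter k phi x))%:C.
  rewrite /F; elim/big_rec2: _ => // k y z _ <-.
  by [].
pose U := \big[setU/set0]_(k < N) (iter k phi @^-1` B).
have mU : measurable U.
  by apply: bigsetU_measurable => k _; exact: (measurable_preimage_iter hphi).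
rewrite (@rnorm_indic _ _ _ _ _ _ _ U)//.
  rewrite (measure_tower hphi mB Bk) fineM//.
  by rewrite fin_num_measure.
move=> x; rewrite FE indicE /U -(bigcup_mkord N (fun k => iter k phi @^-1` B)).
have [xU|xU] := boolP (x \in _); last first.
  rewrite big1 ?normc0// => k _; rewrite indicE (_ : _ \in _ = false) ?mulr0//.
  apply/negP => /set_mem Bk'; move/negP: xU; apply; apply/mem_set.
  by exists k => //=.
have [k /= kN Bkx] := set_mem xU.
rewrite (bigD1 (Ordinal kN))//= indicE mem_set// mulr1 big1 ?addr0 ?na//.
move=> j jk; rewrite indicE (_ : _ \in _ = false) ?mulr0//.
apply/negP => /set_mem Bjx; move/trivIsetP: (tower_disjoint Bk).
move=> /(_ j k (ltnW (ltn_ord j)) (ltnW kN) jk) BB.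
by change (set0 x); rewrite -BB.
Qed.

(** For a tower of height [N] the ratio of [|T v - a v|] to [|v|] is at most [2 / N^(1/p)], hence at
    most [e] once [N >= (2 / e)^p]. *)
Lemma aperiodic_koopman : (forall n, (0 < n)%N -> ~ set_periodic mu phi n) ->
  forall a, normc a = 1 -> approx_eigenvalue T a.
Proof.
move=> aper a a1 e e0; have p0 : 0 < p by rewrite (lt_le_trans ltr01).
have [N eN] : exists N, (2 / e) `^ p <= N%:R.
  exists (Num.truncn ((2 / e) `^ p)).+1.
  by have /andP[_ /ltW] := truncn_itv (powR_ge0 (2 / e) p).
have eN' : 2 / e <= N%:R `^ p^-1.
  have e2 : 0 <= 2 / e by rewrite divr_ge0// ltW.
  rewrite -[leLHS]powRr1// -[X in _ `^ X](divff (lt0r_neq0 p0)) powRrM.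
  by rewrite ge0_ler_powR ?nnegrE ?powR_ge0// invr_ge0 ltW.
have [B [mB B0 Bk]] := aperiodic_tower hphi aper N.
have fB0 : 0 < fine (mu B) by rewrite fine_gt0// B0 ltey_eq fin_num_measure.
have [v [rv Tv]] := koopman_tower_vector a1 mB Bk.
have b0 : 0 < fine (mu B) `^ p^-1 by rewrite powR_gt0.
rewrite powRM ?(ltW fB0)// in rv.
have N0 : 0 < N%:R `^ p^-1 :> R by rewrite (lt_le_trans _ eN')// divr_gt0.
exists v; first by rewrite -rnorm_gt0 rv mulr_gt0.
rewrite (le_trans Tv)// rv mulrA ler_pM2r// mulrC -ler_pdivrMr//.
Qed.

Lemma set_periodic_isolated n : (0 < n)%N -> set_periodic mu phi n ->
  isolated_in_spectrum T 1.
Proof.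
move=> n0 nP; have [u u0 Tu] := koopman_fixed_vector.
exact: (periodic_isolated (norm_koopman hphi (p1 := p1)) n0
  (fun v => set_periodic_koopman v nP) u0 Tu).
Qed.

Lemma set_periodic_uniformly_ergodic n : (0 < n)%N -> set_periodic mu phi n ->
  uniformly_ergodic T.
Proof.
move=> n0 nP; exact: (periodic_uniformly_ergodic
  (norm_koopman hphi (p1 := p1)) n0 (fun v => set_periodic_koopman v nP)).
Qed.

Lemma isolated_set_periodic : isolated_in_spectrum T 1 ->
  exists2 n, (0 < n)%N & set_periodic mu phi n.
Proof.
move=> T1; apply: contrapT => aper.
apply: (approx_eigenvalues_not_isolated _ T1); apply: aperiodic_koopman.
by move=> n n0 nP; apply: aper; exists n.
Qed.

Lemma uniformly_ergodic_set_periodic : uniformly_ergodic T ->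
  exists2 n, (0 < n)%N & set_periodic mu phi n.
Proof.
move=> uT; apply: contrapT => aper.
apply: (approx_eigenvalues_not_uniformly_ergodic
  (norm_koopman hphi (p1 := p1)) _ uT); apply: aperiodic_koopman.
by move=> n n0 nP; apply: aper; exists n.
Qed.

End koopman_operator.

Theorem theorem3p6 (R : realType) (d : measure_display)
    (X : measurableType d) (mu : probability X R) (phi : X -> X)
    (hphi : measure_preserving mu phi) :
  [/\ (countably_separated mu ->
        forall (p : R) (p1 : 1 <= p),
          let T := koopman hphi p1 in
          (isolated_in_spectrum T 1 <-> mu_periodic mu phi) /\
          (mu_periodic mu phi <-> uniformly_ergodic T)),
      (forall (p : R) (p1 : 1 <= p),
          let T := koopman hphi p1 in
          (mu_periodic mu phi -> isolated_in_spectrum T 1) /\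
          (isolated_in_spectrum T 1 <-> uniformly_ergodic T)) &
      (forall (p : R) (p1 : 1 <= p),
          isolated_in_spectrum (koopman hphi p1) 1 /\
          uniformly_ergodic (koopman hphi p1) ->
        forall (q : R) (q1 : 1 <= q),
          isolated_in_spectrum (koopman hphi q1) 1 /\
          uniformly_ergodic (koopman hphi q1))].
Proof.
split=> [cs p p1 T|p p1 T|p p1 [T1 _] q q1].
- split; split.
  + by move=> /isolated_set_periodic[n n0]; exact: set_periodic_mu_periodic.
  + by move=> /(mu_periodic_set_periodic hphi)[n]; exact: set_periodic_isolated.
  + move=> /(mu_periodic_set_periodic hphi)[n].
    exact: set_periodic_uniformly_ergodic.
  + by move=> /uniformly_ergodic_set_periodic[n n0];
      exact: set_periodic_mu_periodic.
- split; last split.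
  + by move=> /(mu_periodic_set_periodic hphi)[n]; exact: set_periodic_isolated.
  + by move=> /isolated_set_periodic[n]; exact: set_periodic_uniformly_ergodic.
  + by move=> /uniformly_ergodic_set_periodic[n]; exact: set_periodic_isolated.
(* The exponent [p] does not occur in [nP], which therefore applies to the operator on the space
   with exponent [q]. *)
- have [n n0 nP] := isolated_set_periodic T1; split.
  + exact: set_periodic_isolated n0 nP.
  + exact: set_periodic_uniformly_ergodic n0 nP.
Qed.
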